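(* Let $n,k,r$ be positive integers, $r\ge 3$. Suppose that $\mathcal F_1,\dots,\mathcal F_r\subset\binom{[n]}{k}$ are non-empty and cross-union. If $$\frac{n}{r-1}\le k\le\frac{r-1}{r}\,n,$$ then $$\sum_{1\le i\le r}|\mathcal F_i|\le r\binom{n-1}{k}.$$
   Context: $[n]=\{1,\dots,n\}$ and $\binom{[n]}{k}$ is the collection of all $k$-subsets of $[n]$. Families $\mathcal F_1,\dots,\mathcal F_r$ of subsets of $[n]$ are called cross-union if $F_1\cup\dots\cup F_r\ne[n]$ for all choices of $F_1\in\mathcal F_1,\dots,F_r\in\mathcal F_r$. Non-empty means that each $\mathcal F_i\neq\emptyset$. *)

(* Defs.v *)
From mathcomp Require Import all_boot.

Set Implicit Arguments.
Unset Strict Implicit.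
Unset Printing Implicit Defensive.

(* The ground set [n] is the ordinal type 'I_n. *)

Definition ksubsets (n k : nat) : {set {set 'I_n}} := [set A : {set 'I_n} | #|A| == k].

Definition cross_union (n r : nat) (F : 'I_r -> {set {set 'I_n}}) : Prop :=
  forall A : 'I_r -> {set 'I_n},
    (forall i, A i \in F i) -> \bigcup_(i < r) A i <> [set: 'I_n].

(* Main.v *)
Require Import Defs.
From mathcomp Require Import all_boot all_order all_algebra.
From mathcomp Require Import all_fingroup zify.
Import Order.TTheory GRing.Theory Num.Theory.

(** The proof is a version of Katona's circle method for several families.

Place the ground set on a circle of [n] points by a permutation, and let [A_i]
be the set of starting points of those arcs of length [k] which belong to the
[i]-th family.  The claim is that the sum of the [|A_i|] is at most [r(n - k)]
for every permutation ([one_circle_bound]).  Each [k]-set is an arc equally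
often, so averaging over all permutations replaces [n - k] by
[(n - k) 'C(n, k) / n = 'C(n - 1, k)].

Let [m] be the number of families that have an arc on the circle.  As all
families are non-empty, no choice of one arc from each of these [m] families
covers the circle: the other families could be represented by arbitrary
members.  If [mk < n], then the trivial bound [mn] already suffices, by the
hypotheses on [k] ([few_families_bound]).

The case [mk >= n] is [circle_bound].  There the families are visited
cyclically: from the arc at [x] in one family go to the arc of the next family
that starts at [x + k] or, if there is none, at the last possible point before
[x + k].  The number of points one has to step back is the loss; the points
stepped over are not starting points of that family.  The walk is eventually
periodic.  Along one period of [qm] steps no point is stepped over twice for
the same family, so the total loss is at most the total number of misses, i.e.
of pairs of a family and a non-member among its possible starting points
([periodic_losses_leq]).  On the other hand, the arcs of [m] consecutive steps
do not cover the circle, so their loss exceeds [mk - n] ([short_loss_cover]),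
and the period loses more than [q(mk - n)].  But the walk returns to its origin,
so its loss is congruent to [qmk], hence to [q(mk - n)], modulo [n].  The total
loss is therefore at least [q(mk - n) + n >= mk].  This gives at least [mk]
misses and at most [mn - mk] arcs. *)

(** * A walk through cyclic families of arcs *)

Section CircleWalk.

Local Open Scope ring_scope.

Variables (N m k : nat) (A : 'I_m -> {set 'I_N.+2}).
Local Notation n := N.+2.

Definition circ_arc (x : 'I_n) : {set 'I_n} := [set x + (u : nat)%:R | u : 'I_k].

Hypothesis A_neq0 : forall j, A j != set0.

Lemma lag_ex j y : exists v, y - v%:R \in A j.
Proof.
have /set0Pn[a aA] := A_neq0 j.
by exists (y - a : 'I_n); rewrite natr_Zp subKr.
Qed.

(** The next arc is sought backwards from the end [y] of the current one, so
that consecutive arcs abut or overlap. *)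
Definition lag j y : nat := ex_minn (lag_ex j y).

Lemma lag_mem j y : y - (lag j y)%:R \in A j.
Proof. by rewrite /lag; case: ex_minnP. Qed.

Lemma lag_min j y v : (v < lag j y)%N -> y - v%:R \notin A j.
Proof.
rewrite /lag; case: ex_minnP => l _ lmin vl; apply/negP => /lmin.
by rewrite leqNgt vl.
Qed.

(** A point that is stepped over determines the landing point behind it; this
is why different steps of a periodic walk skip different points. *)
Lemma lagB j y u : (u <= lag j y)%N -> lag j (y - u%:R) = (lag j y - u)%N.
Proof.
move=> ul; rewrite {1}/lag; case: ex_minnP => l lA lmin.
apply/eqP; rewrite eqn_leq; apply/andP; split.
  by apply: lmin; rewrite -addrA -opprD -natrD subnKC // lag_mem.
rewrite leqNgt; apply/negP => ll.
have /lag_min/negP[] : (u + l < lag j y)%N by lia.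
by rewrite natrD opprD addrA.
Qed.

(** A state [s] is a family [s.1] with the starting point [s.2] of an arc. *)
Definition loss (s : 'I_m * 'I_n) : nat := lag (ordS s.1) (s.2 + k%:R).

Definition step (s : 'I_m * 'I_n) : 'I_m * 'I_n :=
  (ordS s.1, s.2 + k%:R - (loss s)%:R).

Definition losses (a : nat) (s : 'I_m * 'I_n) : nat :=
  (\sum_(t < a) loss (iter t step s))%N.

Lemma step_mem s : (step s).2 \in A (step s).1.
Proof. exact: lag_mem. Qed.

Lemma iter_step_index t s : (iter t step s).1 = ((s.1 + t) %% m)%N :> nat.
Proof.
elim: t => [|t IHt] /=; first by rewrite addn0 modn_small.
by rewrite IHt -addn1 modnDml -addnA addn1.
Qed.

(** Written additively because the net displacement may be negative: a single
loss may exceed [k]. *)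
Lemma iter_step_position t s :
  (iter t step s).2 + (losses t s)%:R = s.2 + (t * k)%:R.
Proof.
elim: t => [|t IHt]; first by rewrite /losses big_ord0.
rewrite /losses big_ord_recr /= -/(losses t s) mulSn addnC !natrD addrA subrK.
by rewrite addrAC IHt -addrA [k%:R + _]addrC.
Qed.

Lemma lossesD a b s : losses (a + b) s = (losses a s + losses b (iter a step s))%N.
Proof.
rewrite /losses big_split_ord /=; congr (_ + _)%N.
by apply: eq_bigr => t _; rewrite addnC iterD.
Qed.

Lemma losses_leq a b s : (a <= b)%N -> (losses a s <= losses b s)%N.
Proof. by move/subnKC <-; rewrite lossesD leq_addr. Qed.

(** An arc begins at or before the end of its predecessor, so the arcs leave no
gap up to the furthest end reached. *)
Lemma walk_arcs_cover t s w : (w + losses t s < t.+1 * k)%N ->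
  exists2 i, (i <= t)%N & s.2 + w%:R \in circ_arc (iter i step s).2.
Proof.
elim: t => [|t IHt].
  rewrite /losses big_ord0 addn0 mul1n => wk.
  by exists 0%N => //; apply/imsetP; exists (Ordinal wk).
move=> wlt; case: (ltnP (w + losses t s) (t.+1 * k)) => [/IHt[i it ?]|wge].
  by exists i => //; apply: leqW.
have le_losses := losses_leq t t.+1 s (leqnSn t).
(* The point [s.2 + w] lies beyond the previous arcs, hence not before the
   start [s.2 + t.+1 * k - losses t.+1 s] of the new one. *)
have uk : (w + losses t.+1 s - t.+1 * k < k)%N by lia.
exists t.+1 => //; apply/imsetP; exists (Ordinal uk) => //=.
apply: (addIr (losses t.+1 s)%:R); rewrite [RHS]addrAC (iter_step_position t.+1).
by rewrite -!addrA -!natrD; congr (_ + _%:R); lia.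
Qed.

(** [m] consecutive steps visit each of the [m] families once, so a choice of
arcs can be read off from the walk. *)
Lemma short_loss_cover s :
  s.2 \in A s.1 -> (losses m s + n <= m * k)%N ->
  exists2 x : 'I_m -> 'I_n,
    forall j, x j \in A j & \bigcup_j circ_arc (x j) = setT.
Proof.
move=> sA small; have m_gt0 : (0 < m)%N by case: (s.1) => *; lia.
have iter_mem i : (iter i step s).2 \in A (iter i step s).1.
  by case: i => //= i; exact: step_mem.
(* The time, between 0 and [m - 1], of the visit to the family [j]. *)
pose time (j : 'I_m) := ((j + (m - s.1)) %% m)%N.
have time_index j : (iter (time j) step s).1 = j.
  apply: val_inj; rewrite /= iter_step_index modnDmr addnCA subnKC.
    by rewrite modnDr modn_small.
  exact: ltnW.
exists (fun j => (iter (time j) step s).2) => [j|].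
  by rewrite -[X in A X]time_index.
apply/setP => y; rewrite inE; apply/bigcupP.
have [|i im yin] := walk_arcs_cover m.-1 s (y - s.2)%R.
  rewrite prednK //.
  have := losses_leq m.-1 m s (leq_pred m); have := ltn_ord (y - s.2)%R; lia.
exists (iter i step s).1 => //.
rewrite natr_Zp addrC subrK in yin.
suff -> : time (iter i step s).1 = i by [].
rewrite /time iter_step_index modnDml addnAC subnKC; last exact: ltnW.
by rewrite modnDl modn_small //; lia.
Qed.

(** A walk on finitely many states returns; a shortest return time over all
states makes the states of one period pairwise distinct. *)
Lemma periodic_state (s0 : 'I_m * 'I_n) :
  exists s L, [/\ (0 < L)%N, iter L step s = s &
    {in gtn L &, injective (fun t => iter t step s)}].
Proof.
pose returns L := (0 < L)%N && [exists s, iter L step s == s].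
have [L retL] : exists L, returns L.
  have /injectivePn[a [b neq_ab eq_ab]] :
    ~~ injectiveb (fun t : 'I_(#|{: 'I_m * 'I_n}|.+1) => iter t step s0).
    by apply/injectiveP => /leq_card; rewrite card_ord ltnn.
  wlog lt_ab : a b neq_ab eq_ab / (a < b)%N.
    move=> hyp; case: (ltngtP a b) => [lt|gt|/val_inj ab]; first exact: (hyp a b).
      by apply: (hyp b a) => //; rewrite eq_sym.
    by rewrite ab eqxx in neq_ab.
  exists (b - a)%N; rewrite /returns subn_gt0 lt_ab; apply/existsP.
  by exists (iter a step s0); rewrite -iterD subnK ?eq_ab // ltnW.
case: (ex_minnP (ex_intro _ L retL)) => {retL}{}L /andP[L0 /existsP[s /eqP sL]] minL.
exists s, L; split=> //.
have lt_neq a b : (a < b < L)%N -> iter a step s <> iter b step s.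
  case/andP=> ab bL eq_ab.
  have /minL : returns (b - a)%N; last by lia.
  rewrite /returns subn_gt0 ab; apply/existsP.
  by exists (iter a step s); rewrite -iterD subnK ?eq_ab // ltnW.
move=> a b; rewrite !inE => aL bL eq_ab.
by case: (ltngtP a b) => // lt_ab; [case: (lt_neq a b)|case: (lt_neq b a)];
  rewrite ?lt_ab.
Qed.

(** The left side counts the points that are stepped over during one period.
Each of them is a miss of the family being entered, and it determines the state
in which the step lands, hence the step itself. *)
Lemma periodic_losses_leq s L :
  iter L step s = s -> {in gtn L &, injective (fun t => iter t step s)} ->
  (losses L s <= \sum_j #|~: A j|)%N.
Proof.
move=> sL inj_s.
(* Step [t] skips the points at distance [u < loss] behind the end of its arc. *)
pose T (t : 'I_L) := 'I_(loss (iter t step s)).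
pose skipped (p : {t : 'I_L & T t}) : 'I_m * 'I_n :=
  ((iter (tag p).+1 step s).1,
   (iter (tag p) step s).2 + k%:R - (tagged p : nat)%:R).
have inj_iterS (a b : 'I_L) : iter a.+1 step s = iter b.+1 step s -> a = b.
  have pullback (t : 'I_L) : iter L.-1 step (iter t.+1 step s) = iter t step s.
    (* A periodic step is undone by the rest of the period. *)
    rewrite -iterD addnS -addSn prednK ?(leq_trans _ (ltn_ord t)) //.
    by rewrite addnC iterD sL.
  move=> /(congr1 (iter L.-1 step)); rewrite !pullback => eq_ab.
  by apply: val_inj; apply: inj_s => //; exact: ltn_ord.
have inj_skipped : injective skipped.
  case=> [a u] [b v] eq_skip.
  have eq_index : ordS (iter a step s).1 = ordS (iter b step s).1 :=
    congr1 fst eq_skip.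
  have eq_position : (iter a step s).2 + k%:R - (u : nat)%:R
      = (iter b step s).2 + k%:R - (v : nat)%:R := congr1 snd eq_skip.
  have eq_lag : (loss (iter a step s) - u = loss (iter b step s) - v)%N.
    rewrite -(lagB _ _ _ (ltnW (ltn_ord u))) -(lagB _ _ _ (ltnW (ltn_ord v))).
    by rewrite eq_position eq_index.
  have eq_ab : a = b.
    apply: inj_iterS => /=; congr pair => //.
    have -> : loss (iter a step s) = (u + (loss (iter a step s) - u))%N.
      by rewrite subnKC // ltnW.
    have -> : loss (iter b step s) = (v + (loss (iter b step s) - v))%N.
      by rewrite subnKC // ltnW.
    by rewrite !natrD !opprD !addrA eq_position eq_lag.
  case: b / eq_ab v {eq_skip eq_position eq_index} eq_lag => v eq_lag.
  congr existT; apply: val_inj => /=.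
  by have := ltn_ord u; have := ltn_ord v; lia.
have -> : losses L s = #|skipped @: setT|.
  rewrite card_imset // cardsT card_tagged sumnE big_map big_enum.
  by apply: eq_bigr => t _; rewrite card_ord.
have -> : (\sum_j #|~: A j| = #|[set p | p.2 \notin A p.1]|)%N.
  transitivity (\sum_j \sum_(x | x \notin A j) 1)%N.
    by apply: eq_bigr => j _; rewrite -sum1_card; apply: eq_bigl => x; rewrite inE.
  by rewrite pair_big_dep -sum1_card; apply: eq_bigl => p; rewrite inE.
apply/subset_leq_card/subsetP => _ /imsetP[[t u] _ ->]; rewrite inE.
exact: lag_min.
Qed.

(** Losing more than [m * k - n] in each of the [q] rounds of a period forces,
by divisibility, a total loss of at least [q * (m * k - n) + n]. *)
Lemma circle_misses :
  (n <= m * k)%N ->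
  (forall x : 'I_m -> 'I_n,
     (forall j, x j \in A j) -> \bigcup_j circ_arc (x j) != setT) ->
  (m * k <= \sum_j #|~: A j|)%N.
Proof.
move=> n_le no_cover.
have m_gt0 : (0 < m)%N by case: m n_le.
have [s [L [L_gt0 sL inj_s]]] := periodic_state (Ordinal m_gt0, 0).
apply: leq_trans (periodic_losses_leq _ _ sL inj_s).
have s_mem t : (iter t step s).2 \in A (iter t step s).1.
  by rewrite -sL -iterD -(prednK L_gt0) addnS; exact: step_mem.
have turn_losses t : (m * k - n < losses m (iter t step s))%N.
  rewrite ltnNge; apply/negP => small.
  have [|x xA xcover] := short_loss_cover _ (s_mem t); first by lia.
  by have := no_cover x xA; rewrite xcover eqxx.
(* The family index returns, so the period consists of full rounds. *)
have [q Lq] : exists q, L = (q * m)%N.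
  apply/dvdnP; have := iter_step_index L s; rewrite sL.
  rewrite -{1}(modn_small (ltn_ord s.1)) -{1}[(s.1 : nat)]addn0.
  by move/eqP; rewrite eqn_modDl mod0n eq_sym.
have losses_ge p : (p * (m * k - n).+1 <= losses (p * m) s)%N.
  elim: p => [|p IHp]; first by rewrite mul0n.
  by rewrite mulSn [(p.+1 * m)%N]mulSn addnC [(m + _)%N]addnC lossesD leq_add.
(* The position returns too, so the loss equals the distance [L * k] modulo [n]. *)
have /eqP : (losses L s)%:R = (L * k)%:R :> 'I_n.
  by apply: (addrI s.2); rewrite -iter_step_position sL.
rewrite !Zp_nat -val_eqE /= Lq -mulnA => eq_mod.
have := losses_ge q; set l := losses _ _ in eq_mod * => l_ge.
have q_gt0 : (0 < q)%N by case: q Lq {losses_ge l eq_mod l_ge} L_gt0 => // ->.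
have : (n %| l - q * (m * k - n))%N.
  rewrite -eqn_mod_dvd; last by lia.
  rewrite (eqP eq_mod) -{1}(subnK n_le) mulnDr.
  by rewrite addnC modnMDl.
rewrite mulnS in l_ge.
move/dvdn_leq; rewrite subn_gt0 => multiple_ge.
have /multiple_ge : (q * (m * k - n) < l)%N by lia.
have := leq_pmull (m * k - n) q_gt0; lia.
Qed.

Lemma circle_bound :
  (n <= m * k)%N -> (k <= n)%N ->
  (forall x : 'I_m -> 'I_n,
     (forall j, x j \in A j) -> \bigcup_j circ_arc (x j) != setT) ->
  (\sum_j #|A j| <= m * (n - k))%N.
Proof.
move=> n_le k_le /(circle_misses n_le) misses.
have : (\sum_j #|A j| + \sum_j #|~: A j| = m * n)%N.
  rewrite -big_split /= -[in RHS](card_ord m) -sum_nat_const.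
  by apply: eq_bigr => j _; rewrite cardsC card_ord.
rewrite mulnBr; lia.
Qed.

End CircleWalk.

(** * Averaging over permutations *)

Lemma card_circ_arc N k (x : 'I_N.+2) : (k <= N.+2)%N -> #|circ_arc N k x| = k.
Proof.
move=> kn; rewrite card_imset ?card_ord // => u v /addrI.
rewrite !Zp_nat => /(congr1 val) /=.
by rewrite !modn_small ?(leq_trans (ltn_ord _)) // => /val_inj.
Qed.

Section PermutationAverage.

Variable T : finType.
Implicit Types (A B C : {set T}) (s : {perm T}).

Lemma exists_perm_imset A B : #|A| = #|B| -> exists s, s @: A = B.
Proof.
move=> eqAB.
(* The permutation matches the listings of the points with the members of the
   set put first. *)
pose listing (C : {set T}) := enum C ++ enum (~: C).
have mem_listing C x : x \in listing C.
  by rewrite mem_cat !mem_enum inE orbN.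
have uniq_listing C : uniq (listing C).
  rewrite cat_uniq !enum_uniq andbT /=.
  by apply/hasPn => x; rewrite !mem_enum inE.
have size_listing C : size (listing C) = #|T|.
  by rewrite size_cat -!cardE cardsC.
pose f x := nth x (listing B) (index x (listing A)).
have index_lt x : (index x (listing A) < size (listing B))%N.
  by rewrite size_listing -(size_listing A) index_mem.
have f_inj : injective f.
  move=> x y; rewrite /f (set_nth_default y) // => /eqP.
  rewrite nth_uniq // => /eqP eq_index.
  by rewrite -(nth_index x (mem_listing A x)) eq_index nth_index.
exists (perm f_inj); apply/eqP.
rewrite eqEcard card_imset ?eqAB ?leqnn ?andbT; last exact: perm_inj.
apply/subsetP => _ /imsetP[x xA ->]; rewrite permE /f.
have idx : (index x (listing A) < size (enum B))%N.
  by rewrite -cardE -eqAB cardE index_cat mem_enum xA index_mem mem_enum.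
by rewrite nth_cat idx -mem_enum mem_nth.
Qed.

(** By transitivity all [k]-sets are the image of [A] equally often, and the
[#|T|`!] permutations are shared among them. *)
Lemma card_perm_imset k A B : #|A| = k -> #|B| = k ->
  (#|[set s : {perm T} | s @: A == B]| * 'C(#|T|, k) = #|T|`!)%N.
Proof.
move=> cardA cardB.
have same_count (C : {set T}) : #|C| = k ->
    #|[set s : {perm T} | s @: A == C]| = #|[set s : {perm T} | s @: A == B]|.
  move=> cardC; have [|t tC] := exists_perm_imset B C; first by rewrite cardB.
  rewrite -[RHS](card_imset _ (mulIg t)); apply: eq_card => s.
  have imset_perm (p q : {perm T}) : (p * q)%g @: A = q @: (p @: A).
    by rewrite -imset_comp; apply: eq_imset => x; rewrite permM.
  rewrite inE; apply/idP/imsetP => [/eqP sC|[s' + ->]].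
    exists (s * t^-1)%g; last by rewrite mulgKV.
    rewrite inE imset_perm sC -tC -imset_comp.
    by apply/eqP; rewrite -[RHS]imset_id; apply: eq_imset => x; rewrite /= permK.
  by rewrite inE imset_perm => /eqP ->; rewrite tC.
rewrite -card_draws mulnC -sum_nat_const.
have -> : (#|T|`! = \sum_(s : {perm T}) 1)%N.
  rewrite -cardsT -card_perm sum1_card; apply: eq_card => s.
  by apply/subsetP => x _; rewrite inE.
rewrite (partition_big (fun s : {perm T} => s @: A)
           (mem [set C : {set T} | #|C| == k])) /=; last first.
  by move=> s _; rewrite inE card_imset ?cardA //; exact: perm_inj.
apply: eq_bigr => C; rewrite inE => /eqP cardC.
by rewrite -(same_count C cardC) -sum1_card; apply: eq_bigl => s; rewrite inE.
Qed.

Lemma card_perm_imset_in k A (F : {set {set T}}) :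
  #|A| = k -> (forall B, B \in F -> #|B| = k) ->
  (#|[set s : {perm T} | s @: A \in F]| * 'C(#|T|, k) = #|F| * #|T|`!)%N.
Proof.
move=> cardA cardF; rewrite -sum1_card.
rewrite (partition_big (fun s : {perm T} => s @: A) (mem F)) /=; last first.
  by move=> s; rewrite inE.
rewrite big_distrl -sum_nat_const; apply: eq_bigr => B BF.
rewrite -(card_perm_imset k A B cardA (cardF B BF)); congr (_ * _)%N.
rewrite -sum1_card; apply: eq_bigl => s.
by rewrite !inE andb_idl // => /eqP ->.
Qed.

End PermutationAverage.

(** * One circle *)

(** The bound is equivalent to [r * k <= (r - m) * n].  Here [m <= r - 2], since
[m * k < n <= (r - 1) * k].  For [m <= 1] this follows from the upper bound on [k]; for
[m >= 2] from [m * k < n] and [r <= m * (r - m)]. *)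
Lemma few_families_bound n k r m :
  (3 <= r)%N -> (n <= (r - 1) * k)%N -> (r * k <= (r - 1) * n)%N ->
  (m * k < n)%N -> (m * n <= r * (n - k))%N.
Proof.
move=> r_ge3 n_le k_le mk_lt.
have m_lt : (m + 2 <= r)%N.
  rewrite leqNgt; apply/negP => r_lt.
  have : ((r - 1) * k <= m * k)%N by rewrite leq_mul2r; lia.
  lia.
suff : (r * k <= (r - m) * n)%N by rewrite mulnBr mulnBl; lia.
case: m mk_lt m_lt => [|[|m]] mk_lt m_lt.
- apply: leq_trans k_le _; rewrite leq_mul2r; lia.
- exact: k_le.
rewrite -(leq_pmul2l (ltn0Sn m.+1)).
have r_le : (r <= m.+2 * (r - m.+2))%N by nia.
have : (r * (m.+2 * k) <= r * n)%N by rewrite leq_mul2l ltnW ?orbT.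
have : (r * n <= m.+2 * (r - m.+2) * n)%N by rewrite leq_mul2r r_le orbT.
nia.
Qed.

Lemma one_circle_bound N k r (F : 'I_r -> {set {set 'I_N.+2}})
    (s : {perm 'I_N.+2}) :
  (3 <= r)%N -> (k <= N.+2)%N ->
  (N.+2 <= (r - 1) * k)%N -> (r * k <= (r - 1) * N.+2)%N ->
  (forall i, F i <> set0) -> cross_union F ->
  (\sum_i #|[set x | s @: circ_arc N k x \in F i]| <= r * (N.+2 - k))%N.
Proof.
move=> r_ge3 k_le n_le rk_le F_neq0 cross.
pose A i := [set x | s @: circ_arc N k x \in F i].
pose I := [set i | A i != set0].
have -> : (\sum_i #|A i| = \sum_(i in I) #|A i|)%N.
  rewrite [RHS]big_mkcond /=; apply: eq_bigr => i _; rewrite inE.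
  by case: eqP => // ->; rewrite cards0.
have I_le : (#|I| <= r)%N by rewrite -[X in (_ <= X)%N]card_ord max_card.
case: (leqP N.+2 (#|I| * k)) => [many|few]; last first.
  apply: leq_trans (few_families_bound _ _ _ _ r_ge3 n_le rk_le few).
  rewrite -sum_nat_const; apply: leq_sum => i _.
  by rewrite -[X in (_ <= X)%N]card_ord max_card.
rewrite big_enum_val; apply: leq_trans (_ : (#|I| * (N.+2 - k) <= _)%N); last first.
  by rewrite leq_mul2r I_le orbT.
apply: (circle_bound N #|I| k (fun j => A (enum_val j))) => // [j|x xA].
  by have := enum_valP j; rewrite inE.
apply/negP => /eqP x_cover.
(* Families without an arc on the circle contribute an arbitrary member. *)
have B_exists i : exists B : {set 'I_N.+2}, B \in F i /\
    forall j : 'I_#|I|, enum_val j = i -> s @: circ_arc N k (x j) \subset B.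
  case: (boolP (i \in I)) => [iI|iI].
    exists (s @: circ_arc N k (x (enum_rank_in iI i))); split.
      by have := xA (enum_rank_in iI i); rewrite inE enum_rankK_in.
    move=> j ji; suff -> : enum_rank_in iI i = j by [].
    by apply: enum_val_inj; rewrite enum_rankK_in.
  have /set0Pn[C CF] : F i != set0 by apply/eqP.
  by exists C; split=> // j ji; rewrite -ji enum_valP in iI.
have [B BF] := fin_all_exists B_exists.
apply: (cross B) => [i|]; first by case: (BF i).
apply/setP => y; rewrite inE; apply/bigcupP.
have /bigcupP[j _ yj] : (s^-1)%g y \in \bigcup_j circ_arc N k (x j).
  by rewrite x_cover inE.
exists (enum_val j) => //; have [_ /(_ j erefl)/subsetP] := BF (enum_val j).
by apply; apply/imsetP; exists ((s^-1)%g y); rewrite ?permKV.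
Qed.

(** * The bound for cross-union families *)

Theorem theorem10p2 (n k r : nat) (F : 'I_r -> {set {set 'I_n}}) :
  (0 < n)%N -> (0 < k)%N -> (3 <= r)%N ->
  (forall i : 'I_r, F i \subset ksubsets n k) ->
  (forall i : 'I_r, F i <> set0) ->
  cross_union F ->
  (n%:R / (r%:R - 1) <= k%:R :> rat)%R ->
  (k%:R <= (r%:R - 1) / r%:R * n%:R :> rat)%R ->
  (\sum_(i < r) #|F i| <= r * 'C(n - 1, k))%N.
Proof.
move=> n_gt0 k_gt0 r_ge3 F_sub F_neq0 cross k_ge k_le.
have r1 : (r%:R - 1 = (r - 1)%:R :> rat)%R by rewrite natrB //; lia.
have n_le : (n <= (r - 1) * k)%N.
  move: k_ge; rewrite r1 ler_pdivrMr ?ltr0n; last by lia.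
  by rewrite -natrM ler_nat mulnC.
have rk_le : (r * k <= (r - 1) * n)%N.
  move: k_le; rewrite r1 mulrAC ler_pdivlMr ?ltr0n; last by lia.
  by rewrite -!natrM ler_nat mulnC.
have k_lt : (k < n)%N by nia.
(* [0 < k < n] gives [2 <= n], so that the circle ['I_n] is a ring. *)
case: n => [|[|N]] // in F n_gt0 F_sub F_neq0 cross k_ge k_le n_le rk_le k_lt *.
  by lia.
have card_F i B : B \in F i -> #|B| = k.
  by move/(subsetP (F_sub i)); rewrite inE => /eqP.
have k_len : (k <= N.+2)%N by exact: ltnW.
have circles : (\sum_(s : {perm 'I_N.+2})
    \sum_i #|[set x | s @: circ_arc N k x \in F i]| <= N.+2`! * (r * (N.+2 - k)))%N.
  rewrite -card_Sn -sum_nat_const; apply: leq_sum => s _.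
  exact: one_circle_bound.
have double_count : ((\sum_(s : {perm 'I_N.+2})
    \sum_i #|[set x | s @: circ_arc N k x \in F i]|) * 'C(N.+2, k)
    = N.+2 * N.+2`! * \sum_i #|F i|)%N.
  rewrite exchange_big big_distrl big_distrr /=; apply: eq_bigr => i _.
  transitivity (\sum_(x : 'I_N.+2) #|F i| * N.+2`!)%N; last first.
    by rewrite sum_nat_const card_ord [(#|F i| * _)%N]mulnC mulnA.
  rewrite (eq_bigr (fun s : {perm 'I_N.+2} =>
      \sum_x (s @: circ_arc N k x \in F i))%N); last first.
    move=> s _; rewrite -sum1_card big_mkcond; apply: eq_bigr => x _.
    by rewrite inE; case: ifP.
  rewrite exchange_big big_distrl; apply: eq_bigr => x _ /=.
  have := card_perm_imset_in _ k _ (F i) (card_circ_arc N k x k_len) (card_F i).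
  rewrite card_ord => <-; congr (_ * _)%N.
  rewrite -sum1_card [in RHS]big_mkcond.
  by apply: eq_bigr => s _; rewrite inE; case: ifP.
rewrite -(@leq_pmul2l (N.+2 * N.+2`!)) ?muln_gt0 ?fact_gt0 // -double_count.
apply: leq_trans (_ : N.+2`! * (r * (N.+2 - k)) * 'C(N.+2, k) <= _)%N.
  by rewrite leq_mul2r circles orbT.
rewrite subn1.
have -> : (N.+2 * N.+2`! * (r * 'C(N.+2.-1, k))
    = N.+2`! * r * (N.+2 * 'C(N.+2.-1, k)))%N by lia.
by rewrite mul_bin_down !mulnA.
Qed.
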